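(* Let $p\in\mathbb{C}[X_1,\dots,X_d,T]$. If $N_{\mathcal{L}(\mathcal{D}(\mathbb{R}),\mathcal{S}'(\mathbb{R}^d))}(p)=\{0\}$, then $V(C_{\mathbf{X}}(p))\cap i\mathbb{R}^d=\emptyset$.
   Context: Coordinates on $\mathbb{R}^{d+1}$ are $(\mathbf{x},t)$, $\mathbf{x}\in\mathbb{R}^d$, $t\in\mathbb{R}$, and $\mathbf{X}=(X_1,\dots,X_d)$. $\mathcal{L}(\mathcal{D}(\mathbb{R}),\mathcal{S}'(\mathbb{R}^d))$ is the space of continuous linear maps from $\mathcal{D}(\mathbb{R})$ (inductive limit topology) to $\mathcal{S}'(\mathbb{R}^d)$ (weak-* topology) — the ''distributions tempered in the spatial directions''; each such $u$ is identified with the unique $U\in\mathcal{D}'(\mathbb{R}^{d+1})$ with $\langle U,\varphi\otimes\psi\rangle=\langle u(\varphi),\psi\rangle$ for $\varphi\in\mathcal{D}(\mathbb{R})$, $\psi\in\mathcal{D}(\mathbb{R}^d)$, so it is a subspace of $\mathcal{D}'(\mathbb{R}^{d+1})$ (derivatives in $x_k$ and $t$ are the distributional ones). For $p\in\mathbb{C}[\mathbf{X},T]$, $D_p=p\left(\frac{\partial}{\partial x_1},\dots,\frac{\partial}{\partial x_d},\frac{\partial}{\partial t}\right)$, and for a subspace $S\subset\mathcal{D}'(\mathbb{R}^{d+1})$, $N_S(p)=\{u\in S: D_pu=0,\ u|_{t<0}=0\}$, where $u|_{t<0}$ is the restriction to $\{t<0\}$. Writing $p=a_0+a_1T+\dots+a_nT^n$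 with $a_j\in\mathbb{C}[\mathbf{X}]$, the $\mathbf{X}$-content $C_{\mathbf{X}}(p)$ is the ideal of $\mathbb{C}[\mathbf{X}]$ generated by $a_0,\dots,a_n$. For a set $I\subset\mathbb{C}[\mathbf{X}]$, $V(I)=\{\boldsymbol{\xi}\in\mathbb{C}^d: q(\boldsymbol{\xi})=0\ \forall q\in I\}$. *)

(* Defs.v *)
From HB Require Import structures.
From mathcomp Require Import all_boot all_order all_algebra.
From mathcomp Require Import Rstruct.
From mathcomp Require Import complex.
From mathcomp Require Import mpoly.
From Coquelicot Require Derive.

Set Implicit Arguments.
Unset Strict Implicit.
Unset Printing Implicit Defensive.

Import Order.TTheory GRing.Theory Num.Theory.
Local Open Scope ring_scope.
Local Open Scope complex_scope.

From Stdlib Require Rdefinitions.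
Notation RR := Rdefinitions.R.
Notation CC := (complex RR).

Definition pt (n : nat) := 'I_n -> RR.

Definition upd n (x : pt n) (k : 'I_n) (s : RR) : pt n :=
  fun j => if j == k then s else x j.

Definition pd n (k : 'I_n) (f : pt n -> CC) : pt n -> CC :=
  fun x => (Derive.Derive (fun s => complex.Re (f (upd x k s))) (x k))
           +i* (Derive.Derive (fun s => complex.Im (f (upd x k s))) (x k)).

Definition has_pd n (k : 'I_n) (f : pt n -> CC) : Prop :=
  forall x, Derive.ex_derive (K := Hierarchy.R_AbsRing) (V := Hierarchy.R_NormedModule) (fun s : RR => complex.Re (f (upd x k s))) (x k) /\
            Derive.ex_derive (K := Hierarchy.R_AbsRing) (V := Hierarchy.R_NormedModule) (fun s : RR => complex.Im (f (upd x k s))) (x k).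

Definition iter_pd n (ks : seq 'I_n) (f : pt n -> CC) : pt n -> CC :=
  foldr (fun k g => pd k g) f ks.

Definition cabs (z : CC) : RR := Num.sqrt (complex.Re z ^+ 2 + complex.Im z ^+ 2).

Definition cont_at n (f : pt n -> CC) (x : pt n) : Prop :=
  forall e : RR, 0 < e -> exists2 dl : RR, 0 < dl &
    forall y : pt n, (forall j, `|y j - x j| < dl) -> cabs (f y - f x) < e.

Definition smooth n (f : pt n -> CC) : Prop :=
  forall ks : seq 'I_n,
    (forall x, cont_at (iter_pd ks f) x) /\ (forall k, has_pd k (iter_pd ks f)).

Definition supp_in n (M : RR) (f : pt n -> CC) : Prop :=
  forall x : pt n, (exists j, M < `|x j|) -> f x = 0.

Definition test_fn n (f : pt n -> CC) : Prop :=
  smooth f /\ exists M, supp_in M f.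

Definition sqnorm n (x : pt n) : RR := \sum_(j < n) x j ^+ 2.

Definition schwartz n (f : pt n -> CC) : Prop :=
  smooth f /\ forall (ks : seq 'I_n) (N : nat), exists B : RR,
    forall x, (1 + sqnorm x) ^+ N * cabs (iter_pd ks f x) <= B.

Definition fadd n (f g : pt n -> CC) : pt n -> CC := fun x => f x + g x.
Definition fscale n (a : CC) (f : pt n -> CC) : pt n -> CC := fun x => a * f x.

(* D'(R^n): linear functionals on D(R^n), continuous for the inductive limit
   topology (seminorm estimate on each D_K, K = [-M,M]^n). *)
Definition distribution n (U : (pt n -> CC) -> CC) : Prop :=
  [/\ (forall f g, test_fn f -> test_fn g -> U (fadd f g) = U f + U g),
      (forall a f, test_fn f -> U (fscale a f) = a * U f) &
      (forall M : RR, exists (Cst : RR) (N : nat), forall f (B : RR),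
          test_fn f -> supp_in M f ->
          (forall ks : seq 'I_n, leq (size ks) N ->
             forall x, cabs (iter_pd ks f x) <= B) ->
          cabs (U f) <= Cst * B)].

Definition tempered n (w : (pt n -> CC) -> CC) : Prop :=
  [/\ (forall f g, schwartz f -> schwartz g -> w (fadd f g) = w f + w g),
      (forall a f, schwartz f -> w (fscale a f) = a * w f) &
      (exists (Cst : RR) (N : nat), forall f (B : RR),
          schwartz f ->
          (forall ks : seq 'I_n, leq (size ks) N ->
             forall x, (1 + sqnorm x) ^+ N * cabs (iter_pd ks f x) <= B) ->
          cabs (w f) <= Cst * B)].

(* L(D(R), S'(R^d)): linear maps D(R) -> S'(R^d), continuous from the
   inductive-limit topology to the weak-* topology, i.e. for every psi in S,
   phi |-> <u(phi), psi> is a distribution on R.  R is represented as pt 1. *)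
Definition in_L d (u : (pt 1 -> CC) -> (pt d -> CC) -> CC) : Prop :=
  [/\ (forall phi, test_fn phi -> tempered (u phi)),
      (forall phi1 phi2 psi, test_fn phi1 -> test_fn phi2 -> schwartz psi ->
          u (fadd phi1 phi2) psi = u phi1 psi + u phi2 psi),
      (forall a phi psi, test_fn phi -> schwartz psi ->
          u (fscale a phi) psi = a * u phi psi) &
      (forall psi, schwartz psi -> distribution (fun phi => u phi psi))].

Definition xcoord d (k : 'I_d) : 'I_d.+1 := widen_ord (leqnSn d) k.
Definition tcoord d : 'I_d.+1 := ord_max.

Definition tens d (phi : pt 1 -> CC) (psi : pt d -> CC) : pt d.+1 -> CC :=
  fun y => phi (fun _ => y (tcoord d)) * psi (fun k => y (xcoord k)).

(* The subspace of D'(R^{d+1}) identified with L(D(R), S'(R^d)). *)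
Definition in_S d (U : (pt d.+1 -> CC) -> CC) : Prop :=
  distribution U /\
  exists u, in_L u /\
    forall phi psi, test_fn phi -> test_fn psi -> U (tens phi psi) = u phi psi.

Definition dder n (k : 'I_n) (U : (pt n -> CC) -> CC) : (pt n -> CC) -> CC :=
  fun chi => - U (pd k chi).

Definition iter_dder n (ks : seq 'I_n) (U : (pt n -> CC) -> CC) :=
  foldr (fun k V => dder k V) U ks.

Definition dirs d (m : 'X_{1..d}) (j : nat) : seq 'I_d.+1 :=
  flatten [seq nseq (m i) (xcoord i) | i <- enum 'I_d] ++ nseq j (tcoord d).

Definition Dp d (p : {poly {mpoly CC[d]}}) (U : (pt d.+1 -> CC) -> CC)
  : (pt d.+1 -> CC) -> CC :=
  fun chi => \sum_(j < size p) \sum_(m <- msupp p`_j)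
               (p`_j)@_m * iter_dder (dirs m j) U chi.

(* U|_{t<0} = 0 : U vanishes on test functions whose (compact) support lies
   in the open set {t < 0}. *)
Definition vanishes_tneg d (U : (pt d.+1 -> CC) -> CC) : Prop :=
  forall chi, test_fn chi ->
    (exists2 e : RR, 0 < e & forall y, - e <= y (tcoord d) -> chi y = 0) ->
    U chi = 0.

Definition NS_trivial d (p : {poly {mpoly CC[d]}}) : Prop :=
  forall U, in_S U ->
    (forall chi, test_fn chi -> Dp p U chi = 0) ->
    vanishes_tneg U ->
    forall chi, test_fn chi -> U chi = 0.

Definition in_Xcontent d (p : {poly {mpoly CC[d]}}) (q : {mpoly CC[d]}) : Prop :=
  exists r : 'I_(size p) -> {mpoly CC[d]}, q = \sum_(j < size p) r j * p`_j.

Definition in_V d (I : {mpoly CC[d]} -> Prop) (xi : 'I_d -> CC) : Prop :=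
  forall q, I q -> q.@[xi] = 0.

(* Main.v *)
(* Fix [xi] with all [a_j (i xi) = 0].  The distribution
   [U = e^(i xi.x) (x) delta_0(t)] is killed by [D_p], because
   [D_p U = sum_j a_j(i xi) e^(i xi.x) (x) delta_0^(j)(t)]; it is supported in
   [t = 0], tempered in [x] and nonzero, so [N_S(p)] is not trivial.

   The functional [g |-> int e^(i xi.x) g(x) dx] is realised as the limit along
   a free ultrafilter of Riemann sums on the grids [N^-1 Z^d] in [[-N, N)^d].
   Such a limit exists as soon as the sums stay bounded, it is linear for free,
   and its behaviour under partial derivatives is a summation by parts. *)

Require Import Defs.
From mathcomp Require Import all_boot all_algebra complex mpoly.
From mathcomp Require Import Rstruct.
From mathcomp Require Import all_order boolp classical_sets functions filter.
From mathcomp Require Import reals topology normedtype Rstruct_topology.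
From mathcomp Require Import ring lra.
From Stdlib Require Reals.
From Coquelicot Require Derive Derive_2d Continuity.

Set Implicit Arguments.
Unset Strict Implicit.
Unset Printing Implicit Defensive.

Import Order.TTheory GRing.Theory Num.Theory numFieldNormedType.Exports.

Local Open Scope ring_scope.
Local Open Scope complex_scope.

Local Notation normc := Normc.normc.
Local Notation dlim := Ranalysis1.derivable_pt_lim.
Local Notation cos := Rtrigo_def.cos.
Local Notation sin := Rtrigo_def.sin.
Local Notation exp := Rtrigo_def.exp.

(** * Limits along a free ultrafilter *)

(** Three facts about the functional carry the proof: a bound by a weighted supremum, which serves
    temperedness and continuity on test functions alike; the rule that d/dx_k acts as multiplication
    by [- i xi_k]; and one test function on which it is nonzero. The derivative rule is proved on
    each grid. Shifting by one mesh [h] multiplies the sum by an exact phase, so the only errors are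
    the second order remainders of [g] and of the phase; they are O(h^2) and survive division by
    [h]. The derivatives of delta_0 are never computed. As partial derivatives of test functions
    commute, the t-derivatives stay a common factor of all the terms of one a_j, and that factor
    multiplies a_j(i xi). The value of the limit is never identified, so nonvanishing has to come
    from a lower bound uniform in the grid: the bump is so narrow that Re e^(i xi.x) >= 1/2 on its
    support. *)

Section ComplexNorm.
Variable R : rcfType.
Implicit Types z w : R[i].

Lemma normc_ge0 z : 0 <= normc z.
Proof. by case: z => a b; exact: sqrtr_ge0. Qed.

Lemma normc_Re_le z : `|complex.Re z| <= normc z.
Proof.
case: z => a b /=; rewrite -sqrtr_sqr ler_wsqrtr // lerDl; exact: sqr_ge0.
Qed.

Lemma normc_Im_le z : `|complex.Im z| <= normc z.
Proof.
case: z => a b /=; rewrite -sqrtr_sqr ler_wsqrtr // lerDr; exact: sqr_ge0.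
Qed.

Lemma normc_real (x : R) : normc x%:C = `|x|.
Proof. by rewrite /= expr0n addr0 sqrtr_sqr. Qed.

Lemma normc_im (x : R) : normc (0 +i* x) = `|x|.
Proof. by rewrite /= expr0n add0r sqrtr_sqr. Qed.

Lemma normc_le_ReIm z : normc z <= `|complex.Re z| + `|complex.Im z|.
Proof.
case: z => a b; have -> : a +i* b = a%:C + (0 +i* b) by simpc.
by apply: (le_trans (le_normcD _ _)); rewrite normc_real normc_im /= addr0 add0r.
Qed.

Lemma normc_sum (I : Type) (r : seq I) (P : pred I) (F : I -> R[i]) :
  normc (\sum_(i <- r | P i) F i) <= \sum_(i <- r | P i) normc (F i).
Proof.
elim/big_ind2: _ => [|x1 x2 y1 y2 h1 h2|//]; first by rewrite Normc.normc0.
exact: le_trans (le_normcD _ _) (lerD h1 h2).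
Qed.

Lemma ReB z w : complex.Re (z - w) = complex.Re z - complex.Re w.
Proof. by case: z w => ? ? []. Qed.

Lemma ImB z w : complex.Im (z - w) = complex.Im z - complex.Im w.
Proof. by case: z w => ? ? []. Qed.

Lemma ReM z w :
  complex.Re (z * w) = complex.Re z * complex.Re w - complex.Im z * complex.Im w.
Proof. by case: z w => ? ? []. Qed.

Lemma ImM z w :
  complex.Im (z * w) = complex.Re z * complex.Im w + complex.Im z * complex.Re w.
Proof. by case: z w => ? ? []. Qed.

Lemma Re_sum (I : Type) (r : seq I) (P : pred I) (F : I -> R[i]) :
  complex.Re (\sum_(i <- r | P i) F i) = \sum_(i <- r | P i) complex.Re (F i).
Proof. by elim/big_rec2: _ => //= i y1 [a b] _ <-; case: (F i). Qed.

End ComplexNorm.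

Section UltraLimit.
Variable R : realType.
Implicit Types (s t : nat -> R) (z w : nat -> R[i]).

Lemma omega_subproof : exists G : set_system nat, UltraFilter G /\ (\oo `<=` G)%classic.
Proof. exact: ultraFilterLemma. Qed.

Definition omega : set_system nat := projT1 (cid omega_subproof).

Instance omega_ultra : UltraFilter omega.
Proof. exact: (projT2 (cid omega_subproof)).1. Qed.

Lemma omega_ge N (P : nat -> Prop) : (forall n, (N <= n)%N -> P n) -> omega P.
Proof. by move=> NP; apply: (projT2 (cid omega_subproof)).2; exists N. Qed.

Definition rlim s : R := lim (s n @[n --> omega])%classic.

Lemma rlim_cvg s B : (forall n, `|s n| <= B) ->
  (s n @[n --> omega] --> rlim s)%classic.
Proof.
move=> sB; have := @segment_compact R (- B) B; rewrite compact_ultra.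
case/(_ (s n @[n --> omega])%classic _ _).
(* The image of [omega] is again an ultrafilter: [omega] decides the preimage of every [A], and a
   finer proper filter cannot contain both [A] and its complement. Compactness of the segment then
   provides the limit. *)
- split=> [|G GF sG]; first exact: fmap_proper_filter.
  apply/seteqP; split=> // A GA.
  have [//|sA] := in_ultra_setVsetC (s @^-1` A)%classic (omega_ultra).
  have /filter_ex [x []] // : G (A `&` ~` A)%classic.
  by apply: filterI => //; exact: sG.
- apply: (@omega_ge 0 (fun n => `[- B, B]%classic (s n))) => n _ /=.
  by rewrite in_itv /= -ler_norml.
- by move=> l [_ sl]; rewrite /rlim (cvg_lim _ sl).
Qed.

Lemma rlim_eq s l : (s n @[n --> omega] --> l)%classic -> rlim s = l.
Proof. exact: cvg_lim. Qed.

Lemma rlim_ge s B c N : (forall n, `|s n| <= B) ->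
  (forall n, (N <= n)%N -> c <= s n) -> c <= rlim s.
Proof.
move=> sB cs; apply: limr_ge; last exact: (omega_ge cs).
by apply: cvgP; exact: rlim_cvg sB.
Qed.

Lemma rlim_norm s B : (forall n, `|s n| <= B) -> `|rlim s| <= B.
Proof.
move=> sB; rewrite ler_norml; apply/andP; split.
  by apply: (rlim_ge (N := 0) sB) => n _; have := sB n; rewrite ler_norml => /andP[].
apply: limr_le; first by apply: cvgP; exact: rlim_cvg sB.
by apply: (@omega_ge 0) => n _; have := sB n; rewrite ler_norml => /andP[].
Qed.

Definition clim z : R[i] :=
  rlim (fun n => complex.Re (z n)) +i* rlim (fun n => complex.Im (z n)).

Definition cbounded z := exists B : R, forall n, normc (z n) <= B.

Lemma cbounded_Re z : cbounded z ->
  ((fun n => complex.Re (z n)) n @[n --> omega] --> complex.Re (clim z))%classic.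
Proof.
by move=> [B zB]; apply: (@rlim_cvg _ B) => n; exact: le_trans (normc_Re_le _) (zB n).
Qed.

Lemma cbounded_Im z : cbounded z ->
  ((fun n => complex.Im (z n)) n @[n --> omega] --> complex.Im (clim z))%classic.
Proof.
by move=> [B zB]; apply: (@rlim_cvg _ B) => n; exact: le_trans (normc_Im_le _) (zB n).
Qed.

Lemma climD z w : cbounded z -> cbounded w ->
  clim (fun n => z n + w n) = clim z + clim w.
Proof.
move=> zb wb; apply/eqP; rewrite eq_complex; apply/andP; split; apply/eqP.
- rewrite raddfD /=; apply: rlim_eq; under eq_fun do rewrite raddfD.
  exact: cvgD (cbounded_Re zb) (cbounded_Re wb).
- rewrite raddfD /=; apply: rlim_eq; under eq_fun do rewrite raddfD.
  exact: cvgD (cbounded_Im zb) (cbounded_Im wb).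
Qed.

Lemma climZ a z : cbounded z -> clim (fun n => a * z n) = a * clim z.
Proof.
move=> zb; have zR := cbounded_Re zb; have zI := cbounded_Im zb.
have aR : (complex.Re a @[_ --> omega] --> complex.Re a)%classic by exact: cvg_cst.
have aI : (complex.Im a @[_ --> omega] --> complex.Im a)%classic by exact: cvg_cst.
apply/eqP; rewrite eq_complex; apply/andP; split; apply/eqP.
- rewrite ReM; apply: rlim_eq; under eq_fun do rewrite ReM.
  exact: cvgB (cvgM aR zR) (cvgM aI zI).
- rewrite ImM; apply: rlim_eq; under eq_fun do rewrite ImM.
  exact: cvgD (cvgM aR zI) (cvgM aI zR).
Qed.

(** The factor 2 comes from bounding real and imaginary parts separately; a sharp constant would
    gain nothing in continuity estimates. *)
Lemma clim_norm z B : (forall n, normc (z n) <= B) -> normc (clim z) <= 2 * B.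
Proof.
move=> zB; apply: (le_trans (normc_le_ReIm _)); rewrite mulr2n mulrDl mul1r.
apply: lerD; apply: rlim_norm => n.
  exact: le_trans (normc_Re_le _) (zB n).
exact: le_trans (normc_Im_le _) (zB n).
Qed.

Lemma clim_Re_ge z c N : cbounded z ->
  (forall n, (N <= n)%N -> c <= complex.Re (z n)) -> c <= complex.Re (clim z).
Proof.
move=> [B zB] cz; apply: (rlim_ge (B := B) _ cz) => n.
exact: le_trans (normc_Re_le _) (zB n).
Qed.

Lemma clim0 z C N : cbounded z ->
  (forall n, (N <= n)%N -> normc (z n) <= C / n.+1%:R) -> clim z = 0.
Proof.
have rlim0 s B D : (forall n, `|s n| <= B) ->
    (forall n, (N <= n)%N -> `|s n| <= D / n.+1%:R) -> rlim s = 0.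
  move=> sB sD; apply/eqP; rewrite -normr_le0; apply/ler_addgt0Pl => e e0; rewrite addr0.
  pose N' := maxn N (Num.truncn (D / e)).
  have De n : (N' <= n)%N -> `|s n| <= e.
    rewrite geq_max => /andP[Nn Dn]; apply: le_trans (sD n Nn) _.
    rewrite ler_pdivrMr // mulrC -ler_pdivrMr //.
    by apply: ltW; apply: lt_le_trans (truncnS_gt _) _; rewrite ler_nat.
  rewrite ler_norml; apply/andP; split.
    by apply: (rlim_ge (N := N') sB) => n /De; rewrite ler_norml => /andP[].
  apply: limr_le; first by apply: cvgP; exact: rlim_cvg sB.
  by apply: (@omega_ge N') => n /De; rewrite ler_norml => /andP[].
move=> [B zB] zC; rewrite /clim !(rlim0 _ B C) // => n.
- exact: le_trans (normc_Im_le _) (zB n).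
- by move=> /zC; exact: le_trans (normc_Im_le _).
- exact: le_trans (normc_Re_le _) (zB n).
- by move=> /zC; exact: le_trans (normc_Re_le _).
Qed.

End UltraLimit.

(** * Riemann sums on cubic grids *)

Section LatticeSums.
Variable d : nat.
Implicit Types (n : nat) (x : pt d) (g : pt d -> CC) (k : 'I_d).

(* The cube [-N, N)^d with N = n + 1, cut with mesh 1 / N. *)
Definition mesh n : RR := n.+1%:R^-1.
Definition node n (a : nat) : RR := a%:R / n.+1%:R - n.+1%:R.
Notation lattice n := {ffun 'I_d -> 'I_((n.+1 ^ 2).*2)}.
Definition lpt n (i : lattice n) : pt d := fun k => node n (i k).
Definition riemann n g : CC := (mesh n ^+ d)%:C * \sum_(i : lattice n) g (lpt i).

Lemma mesh_gt0 n : 0 < mesh n.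
Proof. by rewrite invr_gt0 ltr0n. Qed.

Lemma mesh_le1 n : mesh n <= 1.
Proof. by rewrite invf_le1 ?ltr0n // ler1n. Qed.

Lemma nodeS n a : node n a.+1 = node n a + mesh n.
Proof. by rewrite /node /mesh -addn1 natrD; ring. Qed.

Lemma node_first n : node n 0 = - n.+1%:R.
Proof. by rewrite /node mul0r sub0r. Qed.

Lemma node_last n : node n (n.+1 ^ 2).*2 = n.+1%:R.
Proof.
by rewrite /node -mul2n natrM natrX; field; rewrite ?pnatr_eq0 // addrC natr1 pnatr_eq0.
Qed.

(** The origin is itself the node of index [n.+1 ^ 2], so no cell straddles it and absolute values
    can be resolved cell by cell. *)
Lemma node_sign n a : (0 <= node n a) || (node n a.+1 <= 0).
Proof.
have N0 : (0 : RR) < n.+1%:R by rewrite ltr0n.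
rewrite /node subr_ge0 subr_le0 ler_pdivlMr // ler_pdivrMr // -natrM !ler_nat.
by case: leqP.
Qed.

(* The summand is dominated by the increments of x / (1 + |x|). *)
Lemma node_sum n :
  mesh n * \sum_(a < (n.+1 ^ 2).*2) (1 + node n a ^+ 2)^-1 <= 12.
Proof.
pose F (x : RR) := x / (1 + `|x|).
have F1 (x : RR) : `|F x| <= 1.
  have x1 : 0 < 1 + `|x| by have := normr_ge0 x; lra.
  by rewrite normrM normfV (gtr0_norm x1) ler_pdivrMr // mul1r lerDr.
have inv_le (u v : RR) : 0 < u -> 0 < v -> u <= 6 * v -> v^-1 <= 6 * u^-1.
  by move=> u0 v0 uv; rewrite ler_pdivlMr // mulrC ler_pdivrMr.
(* The increment of [F] over a cell is [h] divided by a product of two linear factors, which is at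
   most [6 * (1 + x ^+ 2)] because [h <= 1]. The increments telescope to at most 2, whence 12. *)
have step a : mesh n * (1 + node n a ^+ 2)^-1 <= 6 * (F (node n a.+1) - F (node n a)).
  have := node_sign n a; rewrite nodeS.
  have := mesh_gt0 n; have := mesh_le1 n.
  move: (mesh n) (node n a) => h x h1 h0 /orP[x0|x0].
    rewrite /F !ger0_norm ?addr_ge0 // ?(ltW h0) //.
    have -> : (x + h) / (1 + (x + h)) - x / (1 + x) = h / ((1 + (x + h)) * (1 + x)).
      by field; apply/andP; split; apply: lt0r_neq0; lra.
    by rewrite mulrCA ler_pM2l //; apply: inv_le; nra.
  rewrite /F !ler0_norm //; last by lra.
  have -> : (x + h) / (1 + - (x + h)) - x / (1 + - x) = h / ((1 - (x + h)) * (1 - x)).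
    by field; apply/andP; split; apply: lt0r_neq0; lra.
  by rewrite mulrCA ler_pM2l //; apply: inv_le; nra.
rewrite mulr_sumr; apply: (le_trans (ler_sum _ (fun (a : 'I__) _ => step a))).
rewrite -mulr_sumr -(big_mkord xpredT (fun a => F (node n a.+1) - F (node n a))).
rewrite telescope_sumr //.
have := F1 (node n (n.+1 ^ 2).*2); have := F1 (node n 0).
by rewrite !ler_norml => /andP[? ?] /andP[? ?]; lra.
Qed.

(** The weight (1 + |x|^2)^d dominates the product of the 1 + x_j^2, so the lattice sum is bounded
    by a product of [d] one-dimensional sums, each at most 12 by [node_sum]. The bound does not
    depend on [n]. *)
Lemma riemann_norm n g B :
  (forall x, (1 + sqnorm x) ^+ d * normc (g x) <= B) ->
  normc (riemann n g) <= B * 12 ^+ d.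
Proof.
move=> gB; have h0 := ltW (mesh_gt0 n).
have q0 x : 0 <= sqnorm x by apply: sumr_ge0 => j _; exact: sqr_ge0.
have B0 : 0 <= B.
  apply: le_trans (gB (fun _ => 0)); apply: mulr_ge0 (normc_ge0 _).
  by rewrite exprn_ge0 // addr_ge0.
have gw x : normc (g x) <= B * \prod_(j < d) (1 + x j ^+ 2)^-1.
  have p0 : 0 < \prod_(j < d) (1 + x j ^+ 2).
    by apply: prodr_gt0 => j _; have := sqr_ge0 (x j); lra.
  rewrite prodfV ler_pdivlMr //; apply: le_trans (gB x).
  rewrite mulrC ler_wpM2r ?normc_ge0 //.
  have -> : (1 + sqnorm x) ^+ d = \prod_(j < d) (1 + sqnorm x) by rewrite prodr_const card_ord.
  apply: ler_prod => j _; apply/andP; split; first by have := sqr_ge0 (x j); lra.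
  rewrite lerD2l /sqnorm (bigD1 j) //= lerDl.
  by apply: sumr_ge0 => l _; exact: sqr_ge0.
rewrite /riemann Normc.normcM normc_real ger0_norm ?exprn_ge0 //.
apply: (@le_trans _ _ (mesh n ^+ d *
  \sum_(i : lattice n) B * \prod_(j < d) (1 + node n (i j) ^+ 2)^-1)).
  rewrite ler_wpM2l ?exprn_ge0 //.
  apply: (le_trans (normc_sum _ _ _)); apply: ler_sum => i _; exact: gw.
rewrite -mulr_sumr mulrCA ler_wpM2l //.
rewrite -(bigA_distr_bigA (fun (j : 'I_d) (a : 'I_((n.+1 ^ 2).*2)) => (1 + node n a ^+ 2)^-1)) /=.
rewrite prodr_const card_ord -exprMn lerXn2r ?nnegrE //; last exact: node_sum.
by rewrite mulr_ge0 // sumr_ge0 // => a _; rewrite invr_ge0 addr_ge0 ?sqr_ge0.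
Qed.

Lemma riemannD n f g : riemann n (fun x => f x + g x) = riemann n f + riemann n g.
Proof. by rewrite /riemann big_split /= mulrDr. Qed.

Lemma riemannZ n a g : riemann n (fun x => a * g x) = a * riemann n g.
Proof. by rewrite /riemann -mulr_sumr mulrCA. Qed.

(* Shifting coordinate [k] cyclically permutes the lattice, and the values that
   wrap around vanish. *)
Lemma riemann_shift n k M f : supp_in M f -> M < n.+1%:R ->
  riemann n (fun x => f (upd x k (x k + mesh n))) = riemann n f.
Proof.
move=> sf MN; congr (_ * _).
pose sh (i : lattice n) : lattice n := [ffun j => if j == k then ordS (i k) else i j].
have sh_inj : injective sh.
  move=> i1 i2 /ffunP e; apply/ffunP => j; have := e j; rewrite !ffunE.
  by case: eqP => [->|//]; exact: ordS_inj.
rewrite [RHS](reindex_inj sh_inj) /=; apply: eq_bigr => i _.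
have [last|nlast] := eqVneq (i k).+1 (n.+1 ^ 2).*2; last first.
  congr f; apply/funext => j; rewrite /upd /lpt !ffunE; case: eqP => [_|//].
  by rewrite /= modn_small ?nodeS // ltn_neqAle nlast /=.
rewrite !sf //; exists k; rewrite /upd /lpt ?ffunE eqxx.
  by rewrite /= last modnn node_first normrN normr_nat.
by rewrite -nodeS last node_last normr_nat.
Qed.

End LatticeSums.

(** * Test functions and their partial derivatives *)

Lemma mean_value (f f' : RR -> RR) (a b : RR) : (forall s, dlim f s (f' s)) -> a <= b ->
  exists2 c, a <= c <= b & f b - f a = f' c * (b - a).
Proof.
move=> df; rewrite le_eqVlt => /predU1P[->|ab].
  by exists b; rewrite ?lexx // !subrr mulr0.
have [c [e [/RltP ac /RltP cb]]] := MVT.MVT_cor2 f f' a b (elimT RltP ab) (fun c _ => df c).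
by exists c => //; rewrite !ltW.
Qed.

(** The mean value theorem is applied to [f] and then to [f']. This loses the factor 1/2 of Taylor's
    formula, but only the order in [h] matters. *)
Lemma taylor2 (f f' f'' : RR -> RR) (B : RR) : (forall s, dlim f s (f' s)) ->
    (forall s, dlim f' s (f'' s)) -> (forall s, `|f'' s| <= B) ->
  forall s h, 0 <= h -> `|f (s + h) - f s - h * f' s| <= B * h ^+ 2.
Proof.
move=> df df' f''B s h h0; have [] := mean_value (a := s) (b := s + h) df; first by lra.
move=> c /andP[sc csh] ->; have [c' _ e] := mean_value df' sc.
have -> : f' c * (s + h - s) - h * f' s = h * (f' c - f' s) by ring.
rewrite e normrM normrM (ger0_norm h0) (ger0_norm (_ : 0 <= c - s)); last by lra.
have := normr_ge0 (f'' c'); have := f''B c'; move: `|_| => u uB u0.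
rewrite expr2 mulrCA; apply: ler_pM => //; last by rewrite ler_wpM2l //; lra.
by apply: mulr_ge0; lra.
Qed.

Lemma cabsE z : cabs z = normc z.
Proof. by case: z. Qed.

Section PartialDerivatives.
Variable n : nat.
Implicit Types (f g : pt n -> CC) (x y : pt n) (k l : 'I_n).

Lemma upd_id x k : upd x k (x k) = x.
Proof. by apply/funext => j; rewrite /upd; case: eqP => [->|]. Qed.

Lemma upd_at x k s : upd x k s k = s.
Proof. by rewrite /upd eqxx. Qed.

Lemma upd_upd x k s r : upd (upd x k s) k r = upd x k r.
Proof. by apply/funext => j; rewrite /upd; case: eqP. Qed.

Lemma upd_comm x k l s r : k != l -> upd (upd x k s) l r = upd (upd x l r) k s.
Proof.
by move=> kl; apply/funext => j; rewrite /upd; case: eqP => [->|//]; rewrite eq_sym (negbTE kl).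
Qed.

Lemma pd_lim_Re f k x s : has_pd k f ->
  dlim (fun r => complex.Re (f (upd x k r))) s (complex.Re (pd k f (upd x k s))).
Proof.
move=> /(_ (upd x k s))[+ _]; rewrite upd_at; under eq_fun do rewrite upd_upd.
by move=> /Derive.Derive_correct/Derive.is_derive_Reals; rewrite /pd /= upd_at;
  under [in X in _ -> X]eq_fun do rewrite upd_upd.
Qed.

Lemma pd_lim_Im f k x s : has_pd k f ->
  dlim (fun r => complex.Im (f (upd x k r))) s (complex.Im (pd k f (upd x k s))).
Proof.
move=> /(_ (upd x k s))[_ +]; rewrite upd_at; under eq_fun do rewrite upd_upd.
by move=> /Derive.Derive_correct/Derive.is_derive_Reals; rewrite /pd /= upd_at;
  under [in X in _ -> X]eq_fun do rewrite upd_upd.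
Qed.

Lemma pd_taylor2 f k (B : RR) : has_pd k f -> has_pd k (pd k f) ->
    (forall x, normc (pd k (pd k f) x) <= B) ->
  forall x h, 0 <= h ->
    normc (f (upd x k (x k + h)) - f x - h%:C * pd k f x) <= 2 * (B * h ^+ 2).
Proof.
move=> df ddf fB x h h0; apply: (le_trans (normc_le_ReIm _)).
rewrite mulr2n mulrDl mul1r; apply: lerD.
  have := taylor2 (fun s => pd_lim_Re x s df) (fun s => pd_lim_Re x s ddf)
    (fun s => le_trans (normc_Re_le _) (fB _)) (x k) h0.
  by rewrite upd_id !ReB ReM mul0r subr0.
have := taylor2 (fun s => pd_lim_Im x s df) (fun s => pd_lim_Im x s ddf)
  (fun s => le_trans (normc_Im_le _) (fB _)) (x k) h0.
by rewrite upd_id !ImB ImM mul0r addr0.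
Qed.

Lemma iter_pd_pd ks k f : iter_pd ks (pd k f) = iter_pd (rcons ks k) f.
Proof. by rewrite /iter_pd -cats1 foldr_cat. Qed.

Lemma smooth_pd k f : smooth f -> smooth (pd k f).
Proof. by move=> sf ks; rewrite iter_pd_pd; exact: sf. Qed.

Lemma smooth_has_pd k f : smooth f -> has_pd k f.
Proof. by move=> /(_ [::])[_]; exact. Qed.

Lemma smooth_cont f : smooth f -> forall x, cont_at f x.
Proof. by move=> /(_ [::])[]. Qed.

(** The complement of the closed cube is open, so near such a point the line function being
    differentiated is identically zero. *)
Lemma supp_pd M k f : supp_in M f -> supp_in M (pd k f).
Proof.
move=> sf x [j Mj]; have [e e0 He] : exists2 e : RR, 0 < e &
    forall s, `|s - x k| < e -> f (upd x k s) = 0.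
  have [jk|jk] := eqVneq j k; last first.
    by exists 1 => // s _; apply: sf; exists j; rewrite /upd (negbTE jk).
  exists (`|x k| - M); first by rewrite subr_gt0 -jk.
  move=> s sx; apply: sf; exists k; rewrite upd_at.
  by have := ler_distD s 0 (x k); rewrite !sub0r !normrN => ?; lra.
have loc (F : CC -> RR) : F 0 = 0 ->
    Derive.Derive (fun s => F (f (upd x k s))) (x k) = 0.
  move=> F0; rewrite -[RHS](Derive.Derive_const 0 (x k)); apply: Derive.Derive_ext_loc.
  exists (RIneq.mkposreal e (elimT RltP e0)) => s /RltP /He ->; exact: F0.
by rewrite /pd !loc.
Qed.

Lemma test_pd k f : test_fn f -> test_fn (pd k f).
Proof.
by move=> [sf [M fM]]; split; [exact: smooth_pd | exists M; exact: supp_pd].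
Qed.

End PartialDerivatives.

(** * Boundedness and mixed partial derivatives of test functions *)

Lemma box_bounded (R : realType) n (M : R) (F : ('I_n -> R) -> R) :
    (forall x e, 0 < e -> exists2 dl, 0 < dl &
      forall y, (forall j, `|y j - x j| < dl) -> `|F y - F x| < e) ->
  exists B, forall x, (forall j, `|x j| <= M) -> F x <= B.
Proof.
(* Points are read as row vectors, whose balls are the coordinatewise cubes of the continuity
   hypothesis and in which the cube of half-side [M] is compact. *)
move=> Fc; pose G (v : 'rV[R]_n) : R := F (v ord0).
have Gc : continuous G.
  move=> v; apply/(cvgrPdist_lt (FF := nbhs_filter v)) => e e0.
  have [dl dl0 Hd] := Fc (v ord0) _ e0.
  apply/nbhs_ballP; exists dl => //= w vw.
  rewrite distrC; apply: Hd => j; rewrite distrC; exact: (vw.2 ord0 j).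
pose A := [set v : 'rV[R]_n | forall i, `[- M, M]%classic (v ord0 i)]%classic.
have Ac : compact A.
  by apply: (@rV_compact _ n (fun=> `[- M, M]%classic)) => _; exact: segment_compact.
have [B [_ HB]] := compact_bounded (continuous_compact (continuous_subspaceT Gc) Ac).
exists (B + 1) => x xM.
have Gx : G (\row_j x j) = F x.
  by rewrite /G; congr F; apply/funext => j; rewrite mxE.
have := HB (B + 1); rewrite ltrDl => /(_ ltr01 (G (\row_j x j))).
rewrite /= Gx => H; apply: le_trans (ler_norm _) (H _); exists (\row_j x j) => //.
by move=> j /=; rewrite mxE in_itv /= -ler_norml.
Qed.

Section TestFunctions.
Variable n : nat.
Implicit Types (f : pt n -> CC) (x y : pt n) (k l : 'I_n).

Lemma test_bounded f : test_fn f -> exists B, forall x, normc (f x) <= B.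
Proof.
move=> [sf [M fM]].
have [|B HB] := @box_bounded _ n M (fun x => normc (f x)).
  move=> x e e0; have [dl dl0 Hd] := smooth_cont sf x e0.
  exists dl => // y xy; apply: le_lt_trans (Hd y xy).
  rewrite cabsE; have := le_normcD (f y - f x) (f x).
  have := le_normcD (f x - f y) (f y).
  by rewrite !subrK -[f x - f y]opprB normcN ler_norml /=; lra.
(* Off the cube the bound has to cover the value 0, and [B] may be negative when the cube is
   empty. *)
exists (Num.max 0 B) => x; rewrite le_max.
have [[j Mj]|nM] := pselect (exists j, M < `|x j|).
  by rewrite fM ?Normc.normc0 ?lexx //; exists j.
apply/orP; right; apply: HB => j; rewrite leNgt; apply/negP => Mj.
by apply: nM; exists j.
Qed.

(** Schwarz's theorem on the plane through [x] spanned by the directions [k] and [l]. It is what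
    later lets x-derivatives pass the t-derivatives. *)
Lemma pd_comm f k l : smooth f -> pd k (pd l f) = pd l (pd k f).
Proof.
move=> sf; have [->//|kl] := eqVneq k l; apply/funext => x.
(* [F] stands for the real or the imaginary part; the three hypotheses are all that the argument
   needs to know of it. *)
have swap (F : CC -> RR) (FM : forall z w, `|F z - F w| <= cabs (z - w))
    (FE : forall (g : pt n -> CC) i s, smooth g ->
        Derive.Derive (fun r => F (g (upd s i r))) (s i) = F (pd i g s))
    (Fd : forall (g : pt n -> CC) i s, smooth g -> Derive.ex_derive (K := Hierarchy.R_AbsRing)
        (V := Hierarchy.R_NormedModule) (fun r => F (g (upd s i r))) (s i)) :
    F (pd k (pd l f) x) = F (pd l (pd k f) x).
  pose G u v := F (f (upd (upd x k u) l v)).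
  have FEk g u v : smooth g ->
      Derive.Derive (fun r => F (g (upd (upd x k r) l v))) u
        = F (pd k g (upd (upd x k u) l v)).
    move=> sg; rewrite -FE // (upd_comm _ _ _ kl) upd_at; congr Derive.Derive.
    by apply/funext => r; rewrite upd_upd (upd_comm _ _ _ kl).
  have FEl g u v : smooth g ->
      Derive.Derive (fun r => F (g (upd (upd x k u) l r))) v
        = F (pd l g (upd (upd x k u) l v)).
    move=> sg; rewrite -FE // upd_at; congr Derive.Derive.
    by apply/funext => r; rewrite upd_upd.
  have Fdk g u v : smooth g -> Derive.ex_derive (K := Hierarchy.R_AbsRing)
        (V := Hierarchy.R_NormedModule) (fun r => F (g (upd (upd x k r) l v))) u.
    move=> sg; have := Fd g k (upd (upd x k u) l v) sg.
    rewrite (upd_comm _ _ _ kl) upd_at; apply: Derive.ex_derive_ext => r.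
    by rewrite upd_upd (upd_comm _ _ _ kl).
  have Fdl g u v : smooth g -> Derive.ex_derive (K := Hierarchy.R_AbsRing)
        (V := Hierarchy.R_NormedModule) (fun r => F (g (upd (upd x k u) l r))) v.
    move=> sg; have := Fd g l (upd (upd x k u) l v) sg.
    by rewrite upd_at; apply: Derive.ex_derive_ext => r; rewrite upd_upd.
  have Fct g : smooth g ->
      Continuity.continuity_2d_pt (fun u v => F (g (upd (upd x k u) l v))) (x k) (x l).
    move=> sg eps; have e0 : 0 < RIneq.pos eps by apply/RltP; exact: RIneq.cond_pos.
    have [dl dl0 Hd] := smooth_cont sg x e0.
    exists (RIneq.mkposreal dl (elimT RltP dl0)) => u v /RltP ux /RltP vx.
    apply/RltP; rewrite upd_id upd_id; apply: le_lt_trans (FM _ _) (Hd _ _) => j.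
    by rewrite /upd; case: eqP => [->//|_]; case: eqP => [->//|_]; rewrite subrr normr0.
  have sk := smooth_pd k sf; have sl := smooth_pd l sf.
  have skl := smooth_pd k sl; have slk := smooth_pd l sk.
  have Dk : (fun u v => Derive.Derive (fun r => G r v) u) =
      fun u v => F (pd k f (upd (upd x k u) l v)).
    by apply/funext => u; apply/funext => v; exact: FEk.
  have Dl : (fun u v => Derive.Derive (fun r => G u r) v) =
      fun u v => F (pd l f (upd (upd x k u) l v)).
    by apply/funext => u; apply/funext => v; exact: FEl.
  have Dkl u v : Derive.Derive (fun z => Derive.Derive (fun t => G z t) v) u =
      F (pd k (pd l f) (upd (upd x k u) l v)).
    by under eq_fun do rewrite FEl //; exact: FEk.
  have Dlk u v : Derive.Derive (fun z => Derive.Derive (fun t => G t z) u) v =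
      F (pd l (pd k f) (upd (upd x k u) l v)).
    by under eq_fun do rewrite FEk //; exact: FEl.
  have := Derive_2d.Schwarz G (x k) (x l); rewrite Dkl Dlk !upd_id; apply.
  - exists (RIneq.mkposreal 1 RIneq.Rlt_0_1) => u v _ _; split; first exact: Fdk.
    split; first exact: Fdl.
    split; first by under eq_fun do rewrite FEl //; exact: Fdk.
    by under eq_fun do rewrite FEk //; exact: Fdl.
  - under [X in Continuity.continuity_2d_pt X]eq_fun => u do under eq_fun do rewrite Dkl.
    exact: Fct.
  - under [X in Continuity.continuity_2d_pt X]eq_fun => u do under eq_fun do rewrite Dlk.
    exact: Fct.
apply/eqP; rewrite eq_complex; apply/andP; split; apply/eqP; apply: swap => //.
- by move=> z w; rewrite -ReB cabsE; exact: normc_Re_le.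
- by move=> g i s /(smooth_has_pd i)/(_ s)[].
- by move=> z w; rewrite -ImB cabsE; exact: normc_Im_le.
- by move=> g i s /(smooth_has_pd i)/(_ s)[].
Qed.

End TestFunctions.

(** * The Fourier functional *)

Definition cexp (t : RR) : CC := cos t +i* sin t.

Lemma normc_cexp t : normc (cexp t) = 1.
Proof.
rewrite /= addrC; have := Rtrigo1.sin2_cos2 t; rewrite /RIneq.Rsqr => e.
by rewrite (_ : _ + _ = 1) ?sqrtr1.
Qed.

Lemma cexpD s t : cexp (s + t) = cexp s * cexp t.
Proof.
apply/eqP; rewrite eq_complex /=; apply/andP; split; apply/eqP.
  exact: Cos_plus.cos_plus.
by rewrite [RHS]addrC; exact: Rtrigo1.sin_plus.
Qed.

Lemma cexp0 : cexp 0 = 1.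
Proof. by rewrite /cexp Rtrigo_def.cos_0 Rtrigo_def.sin_0. Qed.

Lemma cos_taylor t : `|cos t - 1| <= t ^+ 2.
Proof.
wlog t0 : t / 0 <= t => [H|].
  have [/H//|/ltW t0] := leP 0 t; rewrite -sqrrN -[t]opprK Rtrigo1.cos_neg opprK.
  by apply: H; rewrite oppr_ge0.
have := taylor2 (f := cos) (f' := fun s => - sin s) (f'' := fun s => - cos s) (B := 1)
  Rtrigo_reg.derivable_pt_lim_cos
  (fun s => Ranalysis1.derivable_pt_lim_opp _ _ _ (Rtrigo_reg.derivable_pt_lim_sin s))
  _ 0 t0.
rewrite add0r mul1r Rtrigo_def.cos_0 Rtrigo_def.sin_0 oppr0 mulr0 subr0; apply=> s.
by rewrite normrN ler_norml; have [/RleP ? /RleP ?] := Rtrigo1.COS_bound s; apply/andP.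
Qed.

Lemma sin_taylor t : `|sin t - t| <= t ^+ 2.
Proof.
wlog t0 : t / 0 <= t => [H|].
  have [/H//|/ltW t0] := leP 0 t; rewrite -sqrrN -[in X in `|X|](opprK t) Rtrigo1.sin_neg.
  by rewrite -opprD normrN; apply: H; rewrite oppr_ge0.
have := taylor2 (f := sin) (f' := cos) (f'' := fun s => - sin s) (B := 1)
  Rtrigo_reg.derivable_pt_lim_sin Rtrigo_reg.derivable_pt_lim_cos _ 0 t0.
rewrite add0r mul1r Rtrigo_def.cos_0 Rtrigo_def.sin_0 mulr1 subr0; apply=> s.
by rewrite normrN ler_norml; have [/RleP ? /RleP ?] := Rtrigo1.SIN_bound s; apply/andP.
Qed.

Lemma cexp_taylor t : normc (cexp t - 1 - (0 +i* t)) <= 2 * t ^+ 2.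
Proof.
apply: (le_trans (normc_le_ReIm _)); rewrite !ReB !ImB /= !subr0 mulr2n mulrDl mul1r.
exact: lerD (cos_taylor t) (sin_taylor t).
Qed.

(** Where [g] can be nonzero every coordinate is at most [M] in absolute value, so |x|^2 is at most
    d M^2. *)
Lemma decay_supp d M (B : RR) (g : pt d -> CC) : supp_in M g ->
    (forall x, normc (g x) <= B) ->
  forall x, (1 + sqnorm x) ^+ d * normc (g x) <= (1 + d%:R * M ^+ 2) ^+ d * B.
Proof.
move=> gM gB x; have B0 := le_trans (normc_ge0 _) (gB x).
have dM0 : 0 <= 1 + d%:R * M ^+ 2 by apply: addr_ge0 => //; apply: mulr_ge0 (ler0n _ _) (sqr_ge0 _).
have [xM|nM] := pselect (exists j, M < `|x j|).
  by rewrite gM // Normc.normc0 mulr0 mulr_ge0 ?exprn_ge0.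
have q0 : 0 <= sqnorm x by apply: sumr_ge0 => j _; exact: sqr_ge0.
have qM : sqnorm x <= d%:R * M ^+ 2.
  apply: (@le_trans _ _ (\sum_(j < d) M ^+ 2)); last by rewrite sumr_const card_ord mulr_natl.
  apply: ler_sum => j _; rewrite -[x j ^+ 2]real_normK ?num_real //.
  have xj : `|x j| <= M by rewrite leNgt; apply/negP => Mj; apply: nM; exists j.
  by rewrite lerXn2r ?nnegrE //; exact: le_trans xj.
apply: ler_pM; rewrite ?exprn_ge0 ?normc_ge0 ?addr_ge0 //.
by rewrite lerXn2r ?nnegrE ?lerD2l // addr_ge0.
Qed.

Section FourierFunctional.
Variables (d : nat) (xi : 'I_d -> RR).
Implicit Types (g : pt d -> CC) (x : pt d) (k : 'I_d).

Definition wave x : CC := cexp (\sum_(k < d) xi k * x k).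

Lemma normc_wave x : normc (wave x) = 1.
Proof. exact: normc_cexp. Qed.

Lemma wave_upd x k h : wave (upd x k (x k + h)) = cexp (xi k * h) * wave x.
Proof.
rewrite /wave -cexpD (bigD1 k) //= upd_at [in RHS](bigD1 k) //= addrA -mulrDr (addrC h).
congr (cexp (_ + _)); apply: eq_bigr => j jk; by rewrite /upd (negbTE jk).
Qed.

Definition fsum g (n : nat) : CC := riemann n (fun x => wave x * g x).

(* Stands in for the integral of [wave x * g x] over R^d. *)
Definition fourier g : CC := clim (fsum g).

(** The exponent [d] is the one required by [riemann_norm]; Schwartz functions and bounded functions
    of bounded support both satisfy the condition. *)
Definition decays (B : RR) g := forall x, (1 + sqnorm x) ^+ d * normc (g x) <= B.

Lemma fsum_norm B g n : decays B g -> normc (fsum g n) <= B * 12 ^+ d.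
Proof.
by move=> gB; apply: riemann_norm => x; rewrite Normc.normcM normc_wave mul1r; exact: gB.
Qed.

Lemma fsum_bounded B g : decays B g -> cbounded (fsum g).
Proof. by move=> gB; exists (B * 12 ^+ d) => n; exact: fsum_norm. Qed.

Lemma fsumD f g n : fsum (fun x => f x + g x) n = fsum f n + fsum g n.
Proof. by rewrite /fsum -riemannD; congr riemann; apply/funext => x; rewrite mulrDr. Qed.

Lemma fsumZ a g n : fsum (fun x => a * g x) n = a * fsum g n.
Proof. by rewrite /fsum -riemannZ; congr riemann; apply/funext => x; rewrite mulrCA. Qed.

Lemma fsumB f g n : fsum (fun x => f x - g x) n = fsum f n - fsum g n.
Proof.
by rewrite -mulN1r -fsumZ -fsumD; congr (fsum _ n); apply/funext => x; rewrite mulN1r.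
Qed.

Lemma fourier_norm B g : decays B g -> normc (fourier g) <= 2 * (B * 12 ^+ d).
Proof. by move=> gB; apply: clim_norm => n; exact: fsum_norm. Qed.

Lemma fourierD B C f g : decays B f -> decays C g ->
  fourier (fun x => f x + g x) = fourier f + fourier g.
Proof.
move=> fB gC; rewrite /fourier -(climD (fsum_bounded fB) (fsum_bounded gC)).
by congr clim; apply/funext => n; exact: fsumD.
Qed.

Lemma fourierZ B a g : decays B g -> fourier (fun x => a * g x) = a * fourier g.
Proof.
move=> gB; rewrite /fourier -(climZ _ (fsum_bounded gB)).
by congr clim; apply/funext => n; exact: fsumZ.
Qed.

(** Summation by parts, with [g'] in the role of the k-th partial derivative of [g]: of that
    relation only the second order remainder bound is used. It suffices that the sums of
    [g' + th * g] are O(1 / N). *)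
Lemma fourier_diff M (B : RR) k g g' : supp_in M g -> supp_in M g' ->
    (forall x, normc (g x) <= B) -> (forall x, normc (g' x) <= B) ->
    (forall x h, 0 <= h ->
       normc (g (upd x k (x k + h)) - g x - h%:C * g' x) <= B * h ^+ 2) ->
  fourier g' = - (0 +i* xi k) * fourier g.
Proof.
move=> gM g'M gB g'B gT; pose th := 0 +i* xi k : CC.
have gd := decay_supp gM gB; have g'd := decay_supp g'M g'B.
apply/eqP; rewrite mulNr -addr_eq0 -(fourierZ th gd).
have thgd : exists C, decays C (fun x => th * g x).
  eexists; apply: (@decay_supp _ M (normc th * B)) => x; last first.
    by rewrite Normc.normcM ler_wpM2l ?normc_ge0.
  by move=> /gM ->; rewrite mulr0.
have [C thC] := thgd; rewrite -(fourierD g'd thC); apply/eqP.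
pose A := (1 + d%:R * M ^+ 2) ^+ d * B * 12 ^+ d.
pose A' := (1 + d%:R * (M + 1) ^+ 2) ^+ d * B * 12 ^+ d.
have sumd : exists D, decays D (fun x => g' x + th * g x).
  eexists; apply: (@decay_supp _ M (B + normc th * B)) => x.
    by move=> xM; rewrite g'M // gM // mulr0 addr0.
  apply: (le_trans (le_normcD _ _)); rewrite Normc.normcM.
  by rewrite lerD // ler_wpM2l ?normc_ge0.
have [D /fsum_bounded sumD] := sumd.
(* [A] bounds the sums of [g], and [A'] times h^2 those of the Taylor remainder. From the index
   [Num.truncn M] on, the grid cube contains the support, as the cyclic shift requires. *)
apply: (@clim0 _ _ (2 * xi k ^+ 2 * A + A') (Num.truncn M) sumD) => n Mn.
set h := mesh n; have h0 : 0 < h := mesh_gt0 n; have h1 : h <= 1 := mesh_le1 n.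
have Mn1 : M < n.+1%:R.
  by apply: lt_le_trans (truncnS_gt _) _; rewrite ler_nat.
pose E x := g (upd x k (x k + h)) - g x - h%:C * g' x.
(* The shifted copy of [g] enlarges the support by [h], which is at most 1. *)
have EM : supp_in (M + 1) E.
  move=> x [j Mj]; rewrite /E (gM x); last by exists j; lra.
  rewrite (g'M x); last by exists j; lra.
  rewrite gM ?mulr0 ?subr0 //; exists j; rewrite /upd; case: eqP => [e|_]; last by lra.
  have := ler_normD (x k + h) (- h); rewrite addrK normrN (gtr0_norm h0) -e; lra.
have En : normc (fsum E n) <= A' * h ^+ 2.
  have -> : A' * h ^+ 2 = (1 + d%:R * (M + 1) ^+ 2) ^+ d * (B * h ^+ 2) * 12 ^+ d.
    by rewrite /A'; ring.
  exact: fsum_norm (decay_supp EM (fun x => gT x h (ltW h0))).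
have gn : normc (fsum g n) <= A by exact: fsum_norm gd.
pose S := fsum (fun x => g (upd x k (x k + h))) n.
have ES : fsum E n = S - fsum g n - h%:C * fsum g' n.
  by rewrite -fsumZ -!fsumB.
(* Shift invariance is applied to the product of [wave] and [g]; the wave then releases its phase
   exactly. *)
have shift : fsum g n = cexp (xi k * h) * S.
  rewrite /fsum -(@riemann_shift _ n k M) //; last first.
    by move=> x xM; rewrite gM // mulr0.
  rewrite -riemannZ; congr riemann; apply/funext => x.
  by rewrite wave_upd mulrA.
have Sg : S = cexp (- (xi k * h)) * fsum g n.
  by rewrite shift mulrA -cexpD addNr cexp0 mul1r.
(* Both terms on the right are O(h^2): the first by [cexp_taylor], the second by [En]. Dividing by
   [h = 1 / N] leaves O(1 / N). *)
have key : h%:C * fsum (fun x => g' x + th * g x) n =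
    (cexp (- (xi k * h)) - 1 - (0 +i* (- (xi k * h)))) * fsum g n - fsum E n.
  have -> : 0 +i* (- (xi k * h)) = - (h%:C * th) :> CC by rewrite /th; simpc; rewrite mulrC.
  by rewrite fsumD fsumZ ES Sg; ring.
rewrite -(ler_pM2l h0) -[in X in X <= _](gtr0_norm h0) -normc_real -Normc.normcM key.
apply: (le_trans (le_normcD _ _)); rewrite normcN Normc.normcM.
have -> : h * ((2 * xi k ^+ 2 * A + A') / n.+1%:R) = 2 * xi k ^+ 2 * A * h ^+ 2 + A' * h ^+ 2.
  by rewrite -/(mesh n) -/h; ring.
apply: lerD => //.
rewrite mulrAC; apply: ler_pM => //; rewrite ?normc_ge0 //.
by apply: (le_trans (cexp_taylor _)); rewrite sqrrN exprMn mulrA.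
Qed.

End FourierFunctional.

(** * A smooth bump *)

Lemma dlim_ext (f g : RR -> RR) (x l e : RR) : 0 < e ->
  (forall y, `|y - x| < e -> f y = g y) -> dlim f x l -> dlim g x l.
Proof.
move=> e0 fg /Derive.is_derive_Reals df; apply/Derive.is_derive_Reals.
apply: Derive.is_derive_ext_loc df.
by exists (RIneq.mkposreal e (elimT RltP e0)) => y /RltP /fg.
Qed.

Lemma exp_mulrn (x : RR) n : exp (x *+ n) = exp x ^+ n.
Proof.
elim: n => [|n IH]; first by rewrite mulr0n expr0 Rtrigo_def.exp_0.
by rewrite mulrS exprS -IH; exact: Exp_prop.exp_plus.
Qed.

(** For positive [n], this is the n-th power of y / n <= exp (y / n). *)
Lemma expr_le_exp n (y : RR) : 0 <= y -> y ^+ n <= n%:R ^+ n * exp y.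
Proof.
move=> y0; case: n => [|n].
  by rewrite !expr0 mul1r; have /RleP := Rpower.exp_ineq1_le y; apply: le_trans; rewrite lerDl.
have -> : exp y = exp (y / n.+1%:R) ^+ n.+1.
  by rewrite -exp_mulrn -[_ / _ *+ _]mulr_natr mulfVK // pnatr_eq0.
rewrite -exprMn lerXn2r ?nnegrE //.
  by rewrite mulr_ge0 //; apply/ltW/RltP/Exp_prop.exp_pos.
rewrite mulrC -ler_pdivrMr ?ltr0n //.
by have /RleP := Rpower.exp_ineq1_le (y / n.+1%:R); apply: le_trans; rewrite lerDr.
Qed.

(** The powers of 1/x are included so that the linear span of the family is closed under
    differentiation, see [flat_deriv]. *)
Definition flat (n : nat) (x : RR) : RR := if 0 < x then x^-1 ^+ n * exp (- x^-1) else 0.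

Lemma flat_pos n x : 0 < x -> flat n x = x^-1 ^+ n * exp (- x^-1).
Proof. by rewrite /flat => ->. Qed.

Lemma flat_neg n x : x <= 0 -> flat n x = 0.
Proof. by rewrite /flat leNgt => /negbTE ->. Qed.

Lemma flat_gt0 n x : 0 < x -> 0 < flat n x.
Proof.
move=> x0; rewrite flat_pos // mulr_gt0 ?exprn_gt0 ?invr_gt0 //.
by apply/RltP; exact: Exp_prop.exp_pos.
Qed.

Lemma flat_ge0 n x : 0 <= flat n x.
Proof. by have [/(flat_gt0 n)/ltW|/(flat_neg n)->] := ltP 0 x. Qed.

(** [expr_le_exp] at y = 1/x with exponent n + 2. The quadratic bound makes the difference quotient
    at 0 tend to 0. *)
Lemma flat_le n x : flat n x <= n.+2%:R ^+ n.+2 * x ^+ 2.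
Proof.
have [x0|x0] := ltP 0 x; last first.
  by rewrite flat_neg // mulr_ge0 ?sqr_ge0 ?exprn_ge0.
have y0 : 0 < x^-1 by rewrite invr_gt0.
rewrite flat_pos // -ler_pdivrMr ?exprn_gt0 // mulrAC -exprVn -exprD addn2.
have e0 : 0 < exp (- x^-1) by apply/RltP; exact: Exp_prop.exp_pos.
apply: (@le_trans _ _ (n.+2%:R ^+ n.+2 * exp x^-1 * exp (- x^-1))).
  by rewrite ler_pM2r //; exact: expr_le_exp (ltW y0).
rewrite -mulrA -[exp _ * _]Exp_prop.exp_plus (_ : Rdefinitions.RbaseSymbolsImpl.Rplus _ _ = 0).
  by rewrite Rtrigo_def.exp_0 mulr1.
exact: addrN.
Qed.

Lemma flatS n x : 0 < x -> flat n.+1 x = x^-1 * flat n x.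
Proof. by move=> x0; rewrite !flat_pos // exprS mulrA. Qed.

Lemma dlim_inv (x : RR) : 0 < x -> dlim (fun y => y^-1) x (- x^-1 ^+ 2).
Proof.
move=> x0; apply/Derive.is_derive_Reals.
have := Derive.is_derive_inv (fun y => y) x 1
  (Derive.is_derive_id (K := Hierarchy.R_AbsRing) x) (elimN eqP (lt0r_neq0 x0)).
by rewrite RdivE RpowE RoppE mulN1r exprVn.
Qed.

Lemma flat_deriv n x : dlim (flat n) x (flat n.+2 x - n%:R * flat n.+1 x).
Proof.
have [x0|x0|->] := ltgtP x 0.
- rewrite !flat_neg ?(ltW x0) // mulr0 subr0.
  apply: (@dlim_ext (fun=> 0) _ _ _ (- x)); first by rewrite oppr_gt0.
    by move=> y; rewrite ltr_norml => /andP[_ yx]; rewrite flat_neg //; lra.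
  exact: Ranalysis1.derivable_pt_lim_const.
- elim: n => [|n IH].
    rewrite mul0r subr0; apply: (@dlim_ext (exp \o (fun y => - y^-1)) _ _ _ x) => //.
      move=> y; rewrite ltr_norml => /andP[yx _]; rewrite flat_pos ?expr0 ?mul1r //; lra.
    rewrite flat_pos // mulrC -[x^-1 ^+ 2]opprK.
    apply: (Ranalysis1.derivable_pt_lim_comp (fun y : RR => - y^-1) exp).
      exact: Ranalysis1.derivable_pt_lim_opp (dlim_inv x0).
    exact: Exp_prop.derivable_pt_lim_exp.
  apply: (@dlim_ext (fun y => y^-1 * flat n y) _ _ _ x) => //.
    by move=> y; rewrite ltr_norml => /andP[yx _]; rewrite flatS //; lra.
  have := Ranalysis1.derivable_pt_lim_mult _ _ _ _ _ (dlim_inv x0) IH.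
  rewrite (_ : Rdefinitions.RbaseSymbolsImpl.Rplus _ _ =
     flat n.+3 x - n.+1%:R * flat n.+2 x) //.
  by rewrite RplusE !RmultE !flatS // -[n.+1%:R]natr1; ring.
- rewrite !flat_neg // mulr0 subr0 => eps /RltP eps0.
  pose C : RR := n.+2%:R ^+ n.+2.
  have C0 : 0 < C by rewrite exprn_gt0 // ltr0n.
  have d0 : 0 < eps / C by rewrite divr_gt0.
  exists (RIneq.mkposreal _ (elimT RltP d0)) => h /eqP h0 /RltP /= hd.
  apply/RltP; rewrite RminusE RdivE RminusE RplusE add0r (flat_neg n (lexx 0)) !subr0.
  rewrite RabsE normrM (ger0_norm (flat_ge0 _ _)) normfV ltr_pdivrMr ?normr_gt0 //.
  apply: le_lt_trans (flat_le n h) _; rewrite -[h ^+ 2]real_normK ?num_real // expr2 mulrA.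
  by rewrite ltr_pM2r ?normr_gt0 // mulrC -ltr_pdivlMr.
Qed.

(** A class of continuous functions stable under every partial derivative, so that [smooth], a
    statement on all iterated derivatives, follows by one induction on the list of directions. *)
Inductive flat_algebra n : (pt n -> RR) -> Prop :=
| flat_algebra_cst c : flat_algebra (fun=> c)
| flat_algebra_coord k : flat_algebra (fun x => x k)
| flat_algebraD f g : flat_algebra f -> flat_algebra g -> flat_algebra (fun x => f x + g x)
| flat_algebraM f g : flat_algebra f -> flat_algebra g -> flat_algebra (fun x => f x * g x)
| flat_algebra_comp m f : flat_algebra f -> flat_algebra (fun x => flat m (f x)).

Section FlatAlgebra.
Variable n : nat.
Implicit Types (f : pt n -> RR) (x : pt n) (k : 'I_n).

Lemma flat_algebra_sum (I : Type) (r : seq I) (F : I -> pt n -> RR) :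
  (forall i, flat_algebra (F i)) -> flat_algebra (fun x => \sum_(i <- r) F i x).
Proof.
move=> FA; elim: r => [|i r IH].
  by under eq_fun do rewrite big_nil; exact: flat_algebra_cst.
by under eq_fun do rewrite big_cons; exact: flat_algebraD.
Qed.

Lemma flat_algebra_deriv f k : flat_algebra f -> exists2 f', flat_algebra f' &
  forall x, dlim (fun r => f (upd x k r)) (x k) (f' x).
Proof.
elim=> [c|j|g h gA [g' g'A dg] hA [h' h'A dh]|g h gA [g' g'A dg] hA [h' h'A dh]|m g gA [g' g'A dg]].
- exists (fun=> 0) => [|x]; first exact: flat_algebra_cst.
  exact: Ranalysis1.derivable_pt_lim_const.
- exists (fun=> (j == k)%:R) => [|x]; first exact: flat_algebra_cst.
  rewrite /upd; case: eqP => _; last exact: Ranalysis1.derivable_pt_lim_const.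
  exact: Ranalysis1.derivable_pt_lim_id.
- exists (fun x => g' x + h' x) => [|x]; first exact: flat_algebraD.
  exact: Ranalysis1.derivable_pt_lim_plus (dg x) (dh x).
- exists (fun x => g' x * h x + g x * h' x) => [|x].
    by apply: flat_algebraD; exact: flat_algebraM.
  by have := Ranalysis1.derivable_pt_lim_mult _ _ _ _ _ (dg x) (dh x); rewrite upd_id.
- exists (fun x => (flat m.+2 (g x) + - m%:R * flat m.+1 (g x)) * g' x) => [|x].
    apply: flat_algebraM => //; apply: flat_algebraD; first exact: flat_algebra_comp.
    by apply: flat_algebraM; [exact: flat_algebra_cst | exact: flat_algebra_comp].
  apply: (Ranalysis1.derivable_pt_lim_comp _ (flat m) _ _ _ (dg x)).
  by rewrite upd_id mulNr; exact: flat_deriv.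
Qed.

Lemma flat_algebra_cont f x (e : RR) : flat_algebra f -> 0 < e ->
  exists2 dl, 0 < dl & forall y, (forall j, `|y j - x j| < dl) -> `|f y - f x| < e.
Proof.
move=> fA; elim: fA x e => [c|j|g h _ IHg _ IHh|g h _ IHg _ IHh|m g _ IHg] x e e0.
- by exists 1 => // y _; rewrite subrr normr0.
- by exists e => // y; exact.
- have e2 : 0 < e / 2 by lra.
  have [a a0 Ha] := IHg x _ e2; have [b b0 Hb] := IHh x _ e2.
  exists (Num.min a b) => [|y xy]; first by rewrite lt_min a0.
  have {}Ha : `|g y - g x| < e / 2 by apply: Ha => j; have := xy j; rewrite lt_min => /andP[].
  have {}Hb : `|h y - h x| < e / 2 by apply: Hb => j; have := xy j; rewrite lt_min => /andP[].
  by rewrite opprD addrACA; apply: (le_lt_trans (ler_normD _ _)); lra.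
- pose D := 1 + `|g x| + `|h x|.
  have D0 : 0 < D by have := normr_ge0 (g x); have := normr_ge0 (h x); rewrite /D; lra.
  (* If both factors move by less than [t <= 1], the product moves by less than t + t |g x| + t |h
     x| = t D. *)
  pose t := Num.min 1 (e / D); have t0 : 0 < t by rewrite lt_min ltr01 divr_gt0.
  have t1 : t <= 1 by rewrite ge_min lexx.
  have te : t * D <= e by rewrite -ler_pdivlMr // ge_min lexx orbT.
  have [a a0 Ha] := IHg x _ t0; have [b b0 Hb] := IHh x _ t0.
  exists (Num.min a b) => [|y xy]; first by rewrite lt_min a0.
  have {}Ha : `|g y - g x| < t by apply: Ha => j; have := xy j; rewrite lt_min => /andP[].
  have {}Hb : `|h y - h x| < t by apply: Hb => j; have := xy j; rewrite lt_min => /andP[].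
  have -> : g y * h y - g x * h x = (g y - g x) * (h y - h x) + g x * (h y - h x)
      + h x * (g y - g x) by ring.
  apply: lt_le_trans te.
  apply: (le_lt_trans (ler_normD _ _)); apply: (le_lt_trans (lerD (ler_normD _ _) (lexx _))).
  rewrite !normrM /D; have := normr_ge0 (g x); have := normr_ge0 (h x).
  have := normr_ge0 (g y - g x); have := normr_ge0 (h y - h x).
  move: `|g x| `|h x| `|g y - g x| `|h y - h x| Ha Hb => G H u v; nra.
- have := Ranalysis1.derivable_continuous_pt (flat m) (g x) (exist _ _ (flat_deriv m (g x))).
  move=> /(_ e (elimT RltP e0))[dl [/RltP dl0 Hd]].
  have [a a0 Ha] := IHg x _ dl0; exists a => // y /Ha gyx.
  have [->|/eqP ne] := eqVneq (g y) (g x); first by rewrite subrr normr0.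
  by apply/RltP; apply: Hd; split; [split => // /esym | apply/RltP].
Qed.

Lemma flat_algebra_smooth f : flat_algebra f -> smooth (fun x => (f x)%:C).
Proof.
move=> fA ks; have [g gA ->] : exists2 g, flat_algebra g &
    iter_pd ks (fun x => (f x)%:C) = fun x => (g x)%:C.
  elim: ks => [|k ks [g gA IH]]; first by exists f.
  have [g' g'A dg] := flat_algebra_deriv k gA; exists g' => //=.
  rewrite IH; apply/funext => x; rewrite /pd /= Derive.Derive_const.
  by congr (_ +i* _); apply: Derive.is_derive_unique; apply/Derive.is_derive_Reals.
split=> [x e e0|k x].
  have [dl dl0 Hd] := flat_algebra_cont x gA e0; exists dl => // y /Hd.
  by rewrite cabsE -rmorphB normc_real.
have [g' g'A dg] := flat_algebra_deriv k gA; split; last exact: Derive.ex_derive_const.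
by exists (g' x); apply/Derive.is_derive_Reals; exact: dg.
Qed.

End FlatAlgebra.

Definition bump n (r : RR) (y : pt n) : RR := flat 0 (r ^+ 2 - sqnorm y).

Lemma bump_ge0 n r (y : pt n) : 0 <= bump r y.
Proof. exact: flat_ge0. Qed.

Lemma bump_eq0 n r (y : pt n) : r ^+ 2 <= sqnorm y -> bump r y = 0.
Proof. by move=> ry; rewrite /bump flat_neg //; lra. Qed.

Lemma bump_ge n r s (y : pt n) : s < r ^+ 2 -> sqnorm y <= s ->
  flat 0 (r ^+ 2 - s) <= bump r y.
Proof.
move=> sr ys; rewrite /bump !flat_pos ?expr0 ?mul1r; try lra.
have inc a b : a <= b -> exp a <= exp b.
  rewrite le_eqVlt => /predU1P[->//|/RltP ab]; apply/ltW/RltP.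
  exact: Rpower.exp_increasing.
by apply: inc; rewrite lerN2 lef_pV2 ?posrE; lra.
Qed.

Lemma bump_test n r : 0 < r -> test_fn (fun y : pt n => (bump r y)%:C).
Proof.
move=> r0; split.
  apply: flat_algebra_smooth; apply: flat_algebra_comp; apply: flat_algebraD.
    exact: flat_algebra_cst.
  under eq_fun do rewrite -mulN1r.
  apply: flat_algebraM; first exact: flat_algebra_cst.
  apply: flat_algebra_sum => j; under eq_fun do rewrite expr2.
  by apply: flat_algebraM; exact: flat_algebra_coord.
exists r => y [j rj]; rewrite bump_eq0 //.
rewrite /sqnorm (bigD1 j) //= -[y j ^+ 2]real_normK ?num_real //.
apply: (@le_trans _ _ (`|y j| ^+ 2)); first by rewrite lerXn2r ?nnegrE ?(ltW r0) ?(ltW rj).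
by rewrite lerDl sumr_ge0 // => i _; exact: sqr_ge0.
Qed.

(** * The plane wave at time zero *)

Section Slice.
Variable d : nat.
Implicit Types (x : pt d) (k : 'I_d) (f g : pt d.+1 -> CC) (M : RR).

(** [insub] fails only at the last index, so the default 0 is the time coordinate. *)
Definition at_t0 x : pt d.+1 := fun j => oapp x 0 (insub (val j)).

Definition slice f : pt d -> CC := fun x => f (at_t0 x).

Lemma at_t0_x x k : at_t0 x (xcoord k) = x k.
Proof. by rewrite /at_t0 (valK k). Qed.

Lemma at_t0_t x : at_t0 x (tcoord d) = 0.
Proof. by rewrite /at_t0 insubN //= ltnn. Qed.

Lemma at_t0_upd x k s : at_t0 (upd x k s) = upd (at_t0 x) (xcoord k) s.
Proof.
apply/funext => j; rewrite /at_t0 /upd -val_eqE /=; case: insubP => [i _ <-|] /=.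
  by rewrite -val_eqE.
by case: eqP => // ->; rewrite ltn_ord.
Qed.

Lemma sqnorm_at_t0 x : sqnorm (at_t0 x) = sqnorm x.
Proof.
rewrite /sqnorm big_ord_recr /= at_t0_t expr0n addr0.
by apply: eq_bigr => k _; rewrite at_t0_x.
Qed.

Lemma slice_supp M f : supp_in M f -> supp_in M (slice f).
Proof. by move=> fM x [j Mj]; apply: fM; exists (xcoord j); rewrite at_t0_x. Qed.

Lemma test_decays (g : pt d -> CC) : test_fn g -> exists B, decays B g.
Proof.
move=> tg; have [B gB] := test_bounded tg; have [_ [M gM]] := tg.
by eexists; exact: decay_supp gM gB.
Qed.

Lemma slice_decays f : test_fn f -> exists B, decays B (slice f).
Proof.
move=> tf; have [B fB] := test_bounded tf; have [_ [M fM]] := tf.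
eexists; apply: (decay_supp (slice_supp fM)) => x; exact: fB.
Qed.

End Slice.

Section PlaneWave.
Variables (d : nat) (xi : 'I_d -> RR).
Implicit Types (f g : pt d.+1 -> CC) (phi : pt 1 -> CC) (psi : pt d -> CC).

(* The distribution [e^(i xi.x) (x) delta_0(t)]. *)
Definition wave_delta f : CC := fourier xi (slice f).

Definition origin1 : pt 1 := fun=> 0.

Lemma wave_delta_pd k f : test_fn f ->
  wave_delta (pd (xcoord k) f) = - (0 +i* xi k) * wave_delta f.
Proof.
move=> tf; have tf' := test_pd (xcoord k) tf; have tf'' := test_pd (xcoord k) tf'.
have [B0 fB0] := test_bounded tf; have [B1 fB1] := test_bounded tf'.
have [B2 fB2] := test_bounded tf''; have [sf [M fM]] := tf.
(* [fourier_diff] takes a single constant for the function, its derivative and the remainder; the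
   last is bounded by 2 B2 h^2 through [pd_taylor2]. *)
pose B := `|B0| + `|B1| + 2 * `|B2|.
have := (ler_norm B0, ler_norm B1, ler_norm B2, normr_ge0 B0, normr_ge0 B1, normr_ge0 B2).
move=> [[[[[b0 b1] b2] c0] c1] c2].
apply: (@fourier_diff _ _ M B).
- exact: slice_supp.
- exact: slice_supp (supp_pd _ fM).
- by move=> x; apply: le_trans (fB0 _) _; rewrite /B; lra.
- by move=> x; apply: le_trans (fB1 _) _; rewrite /B; lra.
move=> x h h0; rewrite /slice at_t0_upd -[x k]at_t0_x.
have := pd_taylor2 (smooth_has_pd _ sf) (smooth_has_pd _ (smooth_pd _ sf)) fB2 (at_t0 x) h0.
by move/le_trans; apply; rewrite mulrA ler_wpM2r ?sqr_ge0 // /B; lra.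
Qed.

Lemma wave_delta_distribution : distribution wave_delta.
Proof.
split=> [f g tf tg|a f tf|M].
- have [B fB] := slice_decays tf; have [C gC] := slice_decays tg.
  exact: fourierD fB gC.
- by have [B fB] := slice_decays tf; exact: fourierZ fB.
exists (2 * ((1 + d%:R * M ^+ 2) ^+ d * 12 ^+ d)), 0%N => f B tf fM fB.
have f1 x : normc (slice f x) <= B by rewrite -cabsE; exact: (fB [::]).
rewrite cabsE (_ : _ * B = 2 * ((1 + d%:R * M ^+ 2) ^+ d * B * 12 ^+ d)); last by ring.
exact: fourier_norm (decay_supp (slice_supp fM) f1).
Qed.

Lemma schwartz_decays psi : schwartz psi -> exists B, decays B psi.
Proof. by move=> [_ /(_ [::] d)[B psiB]]; exists B => x; rewrite -cabsE; exact: psiB. Qed.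

Lemma wave_in_L : in_L (fun phi psi => phi origin1 * fourier xi psi).
Proof.
split.
- move=> phi tphi; split=> [f g sf sg|a f sf|].
  + have [B fB] := schwartz_decays sf; have [C gC] := schwartz_decays sg.
    by rewrite (fourierD _ fB gC) mulrDr.
  + by have [B fB] := schwartz_decays sf; rewrite (fourierZ _ _ fB) mulrCA.
  exists (normc (phi origin1) * (2 * 12 ^+ d)), d => f B sf fB.
  rewrite cabsE Normc.normcM -mulrA ler_wpM2l ?normc_ge0 // -mulrA [_ * B]mulrC.
  by apply: fourier_norm => x; rewrite -cabsE; exact: (fB [::]).
- by move=> *; rewrite -mulrDl.
- by move=> *; rewrite -mulrA.
move=> psi spsi; split=> [*|*|M]; [exact: mulrDl | exact: esym (mulrA _ _ _) |].
exists (normc (fourier xi psi)), 0%N => phi B tphi _ phiB.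
rewrite cabsE Normc.normcM mulrC ler_wpM2l ?normc_ge0 // -cabsE; exact: (phiB [::]).
Qed.

Lemma wave_delta_in_S : in_S wave_delta.
Proof.
split; first exact: wave_delta_distribution.
exists (fun phi psi => phi origin1 * fourier xi psi); split; first exact: wave_in_L.
move=> phi psi tphi tpsi; have [B psiB] := test_decays tpsi.
rewrite /wave_delta -(fourierZ _ _ psiB); congr fourier; apply/funext => x.
rewrite /slice /tens at_t0_t; congr (_ * psi _).
by apply/funext => k; exact: at_t0_x.
Qed.

Lemma wave_delta_tneg : vanishes_tneg wave_delta.
Proof.
(* The slice at time 0 vanishes identically, hence equals that of [fscale 0 f], and homogeneity
   gives 0. *)
move=> f tf [e e0 f0]; have -> : wave_delta f = wave_delta (fscale 0 f).
  congr fourier; apply/funext => x; rewrite /slice /fscale mul0r f0 // at_t0_t.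
  by rewrite oppr_le0 ltW.
by have [B fB] := slice_decays tf; rewrite /wave_delta [LHS](fourierZ _ 0 fB) mul0r.
Qed.

Lemma wave_delta_tpd j f k : test_fn f ->
  iter_dder (nseq j (tcoord d)) wave_delta (pd (xcoord k) f) =
    - (0 +i* xi k) * iter_dder (nseq j (tcoord d)) wave_delta f.
Proof.
elim: j f => [|j IH] f tf; first exact: wave_delta_pd.
rewrite /= /dder pd_comm; last by have [] := tf.
by rewrite IH ?mulrN //; exact: test_pd.
Qed.

(** The sign in [dder] cancels the one in the eigenvalue [- c k]. [V] is left general in order to be
    a t-derivative of [wave_delta]. *)
Lemma iter_dder_eigen (V : (pt d.+1 -> CC) -> CC) (c : 'I_d -> CC) (s : seq 'I_d) f :
    (forall k g, test_fn g -> V (pd (xcoord k) g) = - c k * V g) -> test_fn f ->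
  iter_dder [seq xcoord k | k <- s] V f = (\prod_(k <- s) c k) * V f.
Proof.
move=> Vc; elim: s f => [|k s IH] f tf; first by rewrite big_nil mul1r.
rewrite big_cons /= /dder IH; last exact: test_pd.
by rewrite Vc //; ring.
Qed.

Lemma wave_delta_dirs (m : 'X_{1..d}) j f : test_fn f ->
  iter_dder (dirs m j) wave_delta f =
    (\prod_i (0 +i* xi i) ^+ m i) * iter_dder (nseq j (tcoord d)) wave_delta f.
Proof.
move=> tf; rewrite /dirs /iter_dder foldr_cat -!/(iter_dder _ _).
have -> : flatten [seq nseq (m i) (xcoord i) | i <- enum 'I_d] =
    [seq xcoord k | k <- flatten [seq nseq (m i) i | i <- enum 'I_d]].
  by rewrite map_flatten -map_comp; congr flatten; apply: eq_map => i /=; rewrite map_nseq.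
rewrite (iter_dder_eigen (c := fun k => 0 +i* xi k)) //; last first.
  by move=> k g tg; exact: wave_delta_tpd.
congr (_ * _); rewrite big_flatten /= big_map big_enum /=; apply: eq_bigr => i _.
by rewrite big_nseq iter_mulr_1.
Qed.

Lemma wave_delta_Dp (p : {poly {mpoly CC[d]}}) f : test_fn f ->
  in_V (in_Xcontent p) (fun k => 0 +i* xi k) -> Dp p wave_delta f = 0.
Proof.
move=> tf pV; rewrite /Dp big1 // => j _.
under eq_bigr do rewrite wave_delta_dirs // mulrA.
(* For fixed [j] the t-derivative factors out, and the sum over monomials is a_j evaluated at i xi.
   That a_j lies in the content is seen with Kronecker delta coefficients. *)
rewrite -mulr_suml -mevalE pV ?mul0r //.
exists (fun i => (i == j)%:R); rewrite (bigD1 j) //= eqxx mul1r big1 ?addr0 //.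
by move=> i /negbTE ->; rewrite mul0r.
Qed.

(** * Nonvanishing of the plane wave functional *)

Lemma node_count n (rho : RR) : 0 < rho -> rho < 1 ->
  rho <= mesh n * \sum_(a < (n.+1 ^ 2).*2) (`|node n a| <= rho)%R%:R.
Proof.
move=> rho0 rho1; have N0 : (0 : RR) < n.+1%:R by rewrite ltr0n.
(* Only the nodes in [0, rho] are counted: they start at the index [K] of the origin, and there are
   [t] of them, more than rho N. *)
pose t := (Num.truncn (rho * n.+1%:R)).+1; pose K := (n.+1 ^ 2)%N.
have rN : 0 <= rho * n.+1%:R by rewrite mulr_ge0 ?ltW.
have tle : (Num.truncn (rho * n.+1%:R))%:R <= rho * n.+1%:R by rewrite truncn_le.
have tK : (Num.truncn (rho * n.+1%:R) < K)%N.
  rewrite -(ltr_nat RR); apply: le_lt_trans tle _.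
  by rewrite natrX expr2 ltr_pM2r // (lt_le_trans rho1) // ler1n.
have Kt : (K + t <= K.*2)%N by rewrite -addnn leq_add2l.
rewrite -(big_mkord xpredT (fun a => (`|node n a| <= rho)%R%:R)) /=.
rewrite (big_cat_nat (n := K + t)) //= (big_cat_nat (n := K) (p := K + t)) ?leq_addr //=.
have ind0 a b : 0 <= \sum_(a <= i < b) (`|node n i| <= rho)%R%:R :> RR.
  by apply: sumr_ge0 => i _.
have mid : \sum_(K <= i < K + t) (`|node n i| <= rho)%R%:R = t%:R :> RR.
  rewrite (eq_big_nat _ _ (F2 := fun=> 1)) ?sumr_const_nat ?addKn // => i /andP[Ki it].
  have iE : node n i = (i - K)%N%:R / n.+1%:R.
    by rewrite /node natrB // natrX mulrBl expr2 mulfK // lt0r_neq0.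
  have iK : (i - K <= Num.truncn (rho * n.+1%:R))%N by rewrite leq_subLR -ltnS -addnS.
  rewrite iE ger0_norm ?divr_ge0 // ler_pdivrMr //.
  by have -> : (i - K)%N%:R <= rho * n.+1%:R by apply: le_trans tle; rewrite ler_nat.
rewrite mid /mesh mulrC -ler_pdivrMr ?invr_gt0 // invrK.
apply: le_trans (ltW (truncnS_gt _)) _; rewrite -/t.
by have := ind0 0%N K; have := ind0 (K + t)%N K.*2; lra.
Qed.

Lemma wave_delta_neq0 : exists2 f, test_fn f & wave_delta f <> 0.
Proof.
pose s := \sum_(k < d) `|xi k|; have s0 : 0 <= s by apply: sumr_ge0.
(* On the ball of radius [r] the phase is at most r s <= 1/2 in absolute value, so its cosine is at
   least 1 - 1/4. *)
pose r := (2 * (1 + s))^-1; have r0 : 0 < r by rewrite invr_gt0; lra.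
have rs : r * s <= 2^-1.
  have : r * (2 * (1 + s)) = 1 by rewrite mulVf //; apply: lt0r_neq0; lra.
  by move: r r0 => q q0; lra.
exists (fun y => (bump r y)%:C); first exact: bump_test.
pose g (x : pt d) := (bump r (at_t0 x))%:C; pose D : RR := d.+1%:R.
have D1 : 1 <= D by rewrite ler1n.
(* The second entry puts the cube of half-side [rho] where |x|^2 <= r^2 / 2, so the bump is at least
   [c] there; the first gives the [rho < 1] of [node_count]. [D] is d + 1 so as to be at least 1
   even for d = 0. *)
pose rho := Num.min 2^-1 (r / (2 * D)).
have rho0 : 0 < rho by rewrite lt_min invr_gt0 ltr0n divr_gt0 //; lra.
have rho1 : rho < 1 by rewrite gt_min; apply/orP; left; lra.
have rhoD : rho * (2 * D) <= r by rewrite -ler_pdivlMr ?ge_min ?lexx ?orbT //; lra.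
pose c := flat 0 (r ^+ 2 - r ^+ 2 / 2).
have r2 : 0 < r ^+ 2 by rewrite exprn_gt0.
have c0 : 0 < c by apply: flat_gt0; lra.
have big (x : pt d) : (forall j, `|x j| <= rho) -> c <= bump r (at_t0 x).
  move=> xr; apply: bump_ge; first by lra.
  rewrite sqnorm_at_t0; apply: (@le_trans _ _ (\sum_(j < d) rho ^+ 2)).
    apply: ler_sum => j _; rewrite -[x j ^+ 2]real_normK ?num_real //.
    by rewrite lerXn2r ?nnegrE // ltW.
  rewrite sumr_const card_ord -mulr_natl.
  have dD : d%:R <= D by rewrite ler_nat.
  have : (rho * (2 * D)) ^+ 2 <= r ^+ 2 by rewrite lerXn2r ?nnegrE //; nra.
  have -> : (rho * (2 * D)) ^+ 2 = 4 * (D * (D * rho ^+ 2)) by ring.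
  have q0 : 0 <= rho ^+ 2 by exact: sqr_ge0.
  have : d%:R * rho ^+ 2 <= D * rho ^+ 2 by rewrite ler_wpM2r.
  have : D * rho ^+ 2 <= D * (D * rho ^+ 2) by rewrite ler_peMl // mulr_ge0 //; lra.
  by rewrite expr2; lra.
have small (x : pt d) : bump r (at_t0 x) != 0 -> 2^-1 <= cos (\sum_(k < d) xi k * x k).
  move=> bx; have xr : sqnorm x < r ^+ 2.
    by rewrite ltNge -sqnorm_at_t0; apply: contra bx => /bump_eq0 ->.
  have xk k : `|x k| <= r.
    rewrite -(@ler_pXn2r _ 2) ?nnegrE ?(ltW r0) // real_normK ?num_real //.
    apply: le_trans (ltW xr); rewrite /sqnorm (bigD1 k) //= lerDl.
    by apply: sumr_ge0 => j _; exact: sqr_ge0.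
  set t := \sum_(k < d) _; have tr : `|t| <= 2^-1.
    apply: le_trans rs; apply: (le_trans (ler_norm_sum _ _ _)).
    rewrite mulr_sumr; apply: ler_sum => k _; rewrite normrM mulrC.
    by rewrite ler_wpM2r.
  have := cos_taylor t; rewrite -[t ^+ 2]real_normK ?num_real // ler_norml => /andP[+ _].
  by have := normr_ge0 t; nra.
(* The minorant is a product of one-variable indicators, so its lattice sum splits into [d] node
   counts; outside the cube it suffices that the real part is nonnegative. *)
have term (x : pt d) : 2^-1 * c * \prod_(j < d) (`|x j| <= rho)%R%:R <=
    complex.Re (wave xi x * g x).
  rewrite ReM /= mulr0 subr0.
  have [/forallP xr|] := boolP [forall j, `|x j| <= rho].
    rewrite big1 ?mulr1; last by move=> j _; rewrite xr.
    have cb := big x xr; have cs := small x (lt0r_neq0 (lt_le_trans c0 cb)).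
    by apply: ler_pM; rewrite ?invr_ge0 ?(ltW c0).
  rewrite negb_forall => /existsP[j /negbTE xj].
  rewrite (bigD1 j) //= xj mul0r mulr0.
  have [->|/small cx] := eqVneq (bump r (at_t0 x)) 0; first by rewrite mulr0.
  by apply: mulr_ge0 (bump_ge0 _ _); lra.
have [B gB] := slice_decays (bump_test d.+1 r0).
have low : 2^-1 * c * rho ^+ d <= complex.Re (wave_delta (fun y => (bump r y)%:C)).
  apply: (clim_Re_ge (N := 0) (fsum_bounded xi gB)) => n _.
  rewrite /fsum /riemann ReM /= mul0r subr0 Re_sum.
  apply: (@le_trans _ _ (mesh n ^+ d * \sum_(i : {ffun 'I_d -> 'I_((n.+1 ^ 2).*2)})
      2^-1 * c * \prod_(j < d) (`|node n (i j)| <= rho)%R%:R)); last first.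
    rewrite ler_wpM2l ?exprn_ge0 ?(ltW (mesh_gt0 n)) //.
    by apply: ler_sum => i _; exact: term (lpt i).
  rewrite -mulr_sumr mulrCA ler_wpM2l ?mulr_ge0 ?(ltW c0) ?invr_ge0 //.
  rewrite -(bigA_distr_bigA (fun (j : 'I_d) (a : 'I_((n.+1 ^ 2).*2)) => (`|node n a| <= rho)%R%:R)).
  rewrite prodr_const card_ord -exprMn lerXn2r ?nnegrE ?(ltW rho0) //; last exact: node_count.
  by rewrite mulr_ge0 ?(ltW (mesh_gt0 n)) // sumr_ge0.
move=> w0; move: low; rewrite w0 /= leNgt => /negP; apply.
by rewrite !mulr_gt0 ?exprn_gt0 ?invr_gt0.
Qed.

End PlaneWave.

(* If N_S(p) = {0} then V(C_X(p)) does not meet i R^d. *)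
Theorem theorem1p9 (d : nat) (p : {poly {mpoly CC[d]}}) :
  NS_trivial p ->
  ~ (exists xi : 'I_d -> RR, in_V (in_Xcontent p) (fun k => 0 +i* xi k)).
Proof.
move=> Np [xi pV]; have [f tf] := wave_delta_neq0 xi; apply.
apply: Np tf; first exact: wave_delta_in_S.
- by move=> g tg; exact: wave_delta_Dp.
- exact: wave_delta_tneg.
Qed.
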